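(* Let $d\in\mathbb{N}$, let $\boldsymbol{Y}=(Y_{\boldsymbol{i}})_{\boldsymbol{i}\in\mathbb{Z}^d}$ be the tail process of a stationary random field such that $\mathbb{P}(\boldsymbol{Y}\in\mathcal{E}_0)=1$, let $A$ be an arbitrary anchoring function, let $\vartheta_A=\mathbb{P}(A(\boldsymbol{Y})=\boldsymbol{0})$ and let $\boldsymbol{Z}^A=(Z^A_{\boldsymbol{i}})_{\boldsymbol{i}\in\mathbb{Z}^d}$ be the anchored process of $\boldsymbol{Y}$ with respect to $A$. Then for every measurable $h:\mathcal{E}_0\to[0,\infty)$, $$\mathbb{E}[h(\boldsymbol{Y})]=\vartheta_A\sum_{\boldsymbol{k}\in\mathbb{Z}^d}\mathbb{E}\left[h(\varphi_{\boldsymbol{k}}\boldsymbol{Z}^A)\mathbf{1}\{|Z^A_{\boldsymbol{k}}|>1\}\right]=\vartheta_A\,\mathbb{E}\left[\sum_{\boldsymbol{k}\in\mathrm{e}(\boldsymbol{Z}^A)}h(\varphi_{\boldsymbol{k}}\boldsymbol{Z}^A)\right],$$ and $$\mathbb{E}\left[h(\boldsymbol{Z}^A)\right]=\vartheta_A^{-1}\,\mathbb{E}\left[\frac{h(\varphi_A\boldsymbol{Y})}{|\mathrm{e}(\boldsymbol{Y})|}\right].$$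
   Context: $\mathbb{R}^{\mathbb{Z}^d}$ carries the product $\sigma$-algebra. For $\boldsymbol{k}\in\mathbb{Z}^d$ the shift is $\varphi_{\boldsymbol{k}}\boldsymbol{x}=(x_{\boldsymbol{i}+\boldsymbol{k}})_{\boldsymbol{i}\in\mathbb{Z}^d}$. The set of exceedance-points of $\boldsymbol{x}$ is $\mathrm{e}(\boldsymbol{x})=\{\boldsymbol{k}\in\mathbb{Z}^d:|x_{\boldsymbol{k}}|>1\}$, with cardinality $|\mathrm{e}(\boldsymbol{x})|$, and $\mathcal{E}_0=\{\boldsymbol{x}\in\mathbb{R}^{\mathbb{Z}^d}:|x_{\boldsymbol{0}}|>1,\ |\mathrm{e}(\boldsymbol{x})|<\infty\}$. Tail process: a random field $\boldsymbol{Y}$ is the tail process of a (strictly) stationary real-valued random field $\boldsymbol{X}=(X_{\boldsymbol{i}})_{\boldsymbol{i}\in\mathbb{Z}^d}$ if $\mathbb{P}(|Y_{\boldsymbol{0}}|>1)=1$ and, for every $m\in\mathbb{N}$, the conditional distribution of $(u^{-1}X_{\boldsymbol{i}})_{\boldsymbol{i}\in\{-m,\dots,m\}^d}$ given $|X_{\boldsymbol{0}}|>u$ converges weakly, as $u\to\infty$, to the distribution of $(Y_{\boldsymbol{i}})_{\boldsymbol{i}\in\{-m,\dots,m\}^d}$. Anchoring function: a measurable map $A:\mathcal{E}_0\to\mathbb{Z}^d$ such that for all $\boldsymbol{x}\in\mathcal{E}_0$: (i) $A(\boldsymbol{x})\in\mathrm{e}(\boldsymbol{x})$, and (ii) $A(\varphi_{\boldsymbol{k}}\boldsymbol{x})+\boldsymbol{k}=A(\boldsymbol{x})$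 for all $\boldsymbol{k}\in\mathrm{e}(\boldsymbol{x})$. Write $\varphi_A\boldsymbol{x}:=\varphi_{A(\boldsymbol{x})}\boldsymbol{x}$. The anchored process of $\boldsymbol{Y}$ with respect to $A$ is a random element $\boldsymbol{Z}^A$ of $\mathcal{E}_0$ with distribution $\mathbb{P}(\boldsymbol{Z}^A\in\cdot)=\mathbb{P}(\boldsymbol{Y}\in\cdot\mid A(\boldsymbol{Y})=\boldsymbol{0})$; this is well defined since $\vartheta_A>0$ is known to hold for every anchoring function $A$. *)

(* Defs.v *)
From HB Require Import structures.
From mathcomp Require Import all_boot all_order all_algebra finmap.
From mathcomp Require Import all_classical all_reals all_analysis.

Set Implicit Arguments.
Unset Strict Implicit.
Unset Printing Implicit Defensive.

Import Order.TTheory GRing.Theory Num.Theory.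
Import numFieldTopology.Exports numFieldNormedType.Exports.

Local Open Scope classical_set_scope.
Local Open Scope ring_scope.

Section fields.
Variables (d : nat) (R : realType).

Definition cylinders : set (set ('rV[int]_d -> R)) :=
  \bigcup_k preimage_set_system setT (fun x : 'rV[int]_d -> R => x k) measurable.

(* R^(Z^d) with the product sigma-algebra, Z^d being 'rV[int]_d. *)
Definition rfield : Type := g_sigma_algebraType cylinders.

Definition fshift (k : 'rV[int]_d) (x : rfield) : rfield := fun i => x (i + k).

Definition exceed (x : rfield) : set 'rV[int]_d := [set k | 1 < `|x k|].

Definition E0 : set rfield := [set x | 1 < `|x 0| /\ finite_set (exceed x)].

Definition box (m : nat) : set 'rV[int]_d := [set k | forall j, `|k 0 j| <= m%:Z].

(* The index type is the subtype of points of the box, and {ptws _ -> _} carries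
   the product topology, which is the Euclidean one as the box is finite. *)
Definition box_restr (m : nat) (x : rfield) : {ptws box m -> R} :=
  fun i => x (set_val i).

(* Only the values of A on E0 matter. Z^d is discrete and E0 carries the trace
   sigma-algebra. *)
Definition anchoring (A : rfield -> 'rV[int]_d) : Prop :=
  [/\ forall B : set 'rV[int]_d, measurable (E0 `&` A @^-1` B),
      forall x, E0 x -> exceed x (A x)
    & forall x k, E0 x -> exceed x k -> A (fshift k x) + k = A x].

End fields.

Arguments box : clear implicits.
Arguments E0 {d R}.
Arguments box_restr {d R} m x.

Section events.
Context (dT : measure_display) (T : measurableType dT) (R : realType).
Variable P : probability T R.

Definition cond_prob (E F : set T) : R := fine (P (E `&` F)) / fine (P F).

Definition cond_expect (f : T -> R) (F : set T) : R :=
  (\int[P]_(w in F) f w) / fine (P F).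

Variable d : nat.

Definition stationary (X : {RV P >-> rfield d R}) : Prop :=
  forall (k : 'rV[int]_d) (B : set (rfield d R)), measurable B ->
    distribution P X (fshift k @^-1` B) = distribution P X B.

(* The event A(Y) = 0, with A regarded as defined on E0 only. *)
Definition anchored_at0 (Y : {RV P >-> rfield d R}) (A : rfield d R -> 'rV[int]_d) :
  set T := [set w | E0 (Y w) /\ A (Y w) = 0].

Definition vartheta (Y : {RV P >-> rfield d R}) (A : rfield d R -> 'rV[int]_d) : R :=
  fine (P (anchored_at0 Y A)).

End events.

(* The positivity condition is what makes conditioning on |X_0| > u meaningful for
   large u; weak convergence is tested on bounded continuous functions. *)
Definition tail_process (d : nat) (R : realType)
    (dX : measure_display) (OX : measurableType dX) (PX : probability OX R)
    (X : {RV PX >-> rfield d R})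
    (dY : measure_display) (OY : measurableType dY) (PY : probability OY R)
    (Y : {RV PY >-> rfield d R}) : Prop :=
  [/\ PY [set w | 1 < `|Y w 0|] = 1%E,
      forall u : R, (0 < PX [set w | u < `|X w 0|]%R)%E
    & forall (m : nat) (f : {ptws box d m -> R} -> R),
        continuous f -> (exists M : R, forall x, `|f x| <= M) ->
        cond_expect PX (fun w => f (box_restr m (fun i => u^-1 * X w i)))
          [set w | u < `|X w 0|] @[u --> +oo]
        --> \int[PY]_w f (box_restr m (Y w))].

(* As the law of Z has total mass 1 and division by 0 returns 0, this implies
   vartheta Y A > 0. *)
Definition anchored_process (d : nat) (R : realType)
    (dY : measure_display) (OY : measurableType dY) (PY : probability OY R)
    (Y : {RV PY >-> rfield d R}) (A : rfield d R -> 'rV[int]_d)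
    (dZ : measure_display) (OZ : measurableType dZ) (PZ : probability OZ R)
    (Z : {RV PZ >-> rfield d R}) : Prop :=
  (forall w, E0 (Z w)) /\
  forall B : set (rfield d R), measurable B ->
    distribution PZ Z B = (cond_prob PY (Y @^-1` B) (anchored_at0 Y A))%:E.

(* Main.v *)
Require Import Defs.
From HB Require Import structures.
From mathcomp Require Import all_boot all_order all_algebra finmap.
From mathcomp Require Import all_classical all_reals all_analysis.
From mathcomp Require Import measurable_realfun.
Import Order.TTheory GRing.Theory Num.Theory.
Import numFieldTopology.Exports numFieldNormedType.Exports.
Local Open Scope classical_set_scope.
Local Open Scope ring_scope.
Local Open Scope ereal_scope.

(** The law of [Y] alone carries the proof; write [mu] for it.

    Exceedance-shift invariance.  For measurable [F >= 0] that vanishes unless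
    both [|x_0| > 1] and [|x_{-k}| > 1],
    the integrals of [F] and of [F o phi_k] against [mu] agree
    ([tail_integral_shift]).  Indeed a bounded continuous [G] depending on
    finitely many coordinates and vanishing when [|x_0| <= 1] satisfies
    [E G(X/u) / P(|X_0| > u) --> E G(Y)], with no conditioning left in the
    numerator.  If [G] also vanishes when [|x_{-k}| <= 1], this applies to
    [G o phi_k] too, and stationarity of [X] makes the two pre-limit quotients
    equal for every [u].  Approximating indicators of open sets from below by
    continuous functions avoids any discussion of atoms of [|Y_k|] at [1]; open
    cylinders then form a pi-system that determines the law.

    Mass transport.  Let [anchored A] be the event that [x] lies in [E0] with
    anchor [0].  Splitting according to the position [k] of the anchor and moving
    the origin there by the invariance, the integral of [H] over [A = k] becomes
    the integral of [H o phi_{-k}] over [anchored A] ([anchor_transport]).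
    Summing over [k],

      [int H dmu = int_{anchored A} sum_k H(phi_k x) dmu]   ([mass_transport])

    for every [H >= 0] vanishing off [E0].  Since the law of [Z] is [mu]
    restricted to [anchored A] and divided by [vartheta], this is the first
    formula, and Tonelli gives the second one.  The third formula is the same
    identity for [h(phi_A x) / |e(x)|]: this function takes the same value at each
    of the [|e(x)|] shifts of [x] that lie in [E0], so at an anchored [x] its sum
    over shifts is [h x] ([esum_anchor_average]). *)

(** * The product sigma-algebra and its open cylinders *)

Section product_space.
Set Implicit Arguments.
Unset Strict Implicit.
Context {d : nat} {R : realType}.
Local Notation rfield := (rfield d R).
Local Notation index := 'rV[int]_d.
Implicit Types (i k : index) (x : rfield).

Lemma measurable_coord i : measurable_fun setT (fun x : rfield => x i).
Proof.
by move=> _ B mB; apply: sub_sigma_algebra; exists i => //; exists B.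
Qed.

Lemma measurable_fieldP (dT : measure_display) (T : measurableType dT)
    (f : T -> rfield) :
  (forall i, measurable_fun setT (fun t => f t i)) -> measurable_fun setT f.
Proof.
move=> mf; apply: (measurability (@cylinders d R : set (set rfield))) => //.
move=> _ [_ [i _ [B mB <-]] <-]; rewrite !setTI.
by have := mf i measurableT B mB; rewrite setTI.
Qed.

Lemma measurable_fshift k : measurable_fun setT (@fshift d R k).
Proof. by apply: measurable_fieldP => i; exact: measurable_coord. Qed.

Lemma measurable_field_scale (c : R) :
  measurable_fun setT (fun x : rfield => (fun i => c * x i)%R : rfield).
Proof.
apply: measurable_fieldP => i.
by apply: measurable_funM => //; exact: measurable_coord.
Qed.

Lemma fshiftD k l x : fshift k (fshift l x) = fshift (k + l)%R x.
Proof. by apply/funext => i; rewrite /fshift addrA. Qed.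

Lemma fshift0 x : fshift 0%R x = x.
Proof. by apply/funext => i; rewrite /fshift addr0. Qed.

(** A syntactic class of continuous functions of finitely many coordinates.  The
    sets on which such a function is positive are open cylinders, and they are
    stable under intersection because the class is stable under minima; shifting,
    measurability and factorization through a box all follow by induction. *)
Inductive finite_min : (rfield -> R) -> Prop :=
| finite_min_coord i (g : R -> R) :
    continuous g -> finite_min (fun x => g (x i))
| finite_min_min F G : finite_min F -> finite_min G ->
    finite_min (fun x => Num.min (F x) (G x)).

Lemma finite_min_shift k F :
  finite_min F -> finite_min (fun x => F (fshift k x)).
Proof.
elim=> [i g cg|F1 F2 _ IH1 _ IH2]; last exact: finite_min_min.
exact: finite_min_coord.
Qed.

Lemma finite_min_measurable F : finite_min F -> measurable_fun setT F.
Proof.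
elim=> [i g cg|F1 F2 _ IH1 _ IH2]; last exact: measurable_minr.
apply: measurableT_comp; last exact: measurable_coord.
exact: continuous_measurable_fun.
Qed.

(** Weak convergence is tested on continuous functions of a box of coordinates.
    Asking for a factorization through all large boxes, rather than through one,
    lets two functions be factored through a common box. *)
Lemma finite_min_box F : finite_min F ->
  \forall m \near \oo, exists2 f : {ptws box d m -> R} -> R,
    continuous f & forall x, F x = f (box_restr m x).
Proof.
elim=> [i g cg|F1 F2 _ IH1 _ IH2].
  (* the sup-norm of i: all larger boxes contain i *)
  exists (\max_j `|i ord0 j|%N) => // m /= im.
  have bi : box d m i.
    move=> j; rewrite -abszE lez_nat; apply: leq_trans im.
    by rewrite (ord1 0%R) (leq_bigmax j).
  exists (fun y => g (y (SigSub (mem_set bi)))) => // y.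
  apply: (@continuous_comp _ _ _ (fun y : {ptws box d m -> R} => y _) g).
    exact: (@proj_continuous (box d m) (fun=> R)).
  exact: cg.
apply: filterS2 IH1 IH2 => m [f1 cf1 F1f1] [f2 cf2 F2f2].
exists (fun y => Num.min (f1 y) (f2 y)) => [y|x]; last by rewrite F1f1 F2f2.
exact: (continuous_min (cf1 y) (cf2 y)).
Qed.

Lemma measurable_pos_set (dT : measure_display) (T : measurableType dT)
    (F : T -> R) :
  measurable_fun setT F -> measurable [set t | 0 < F t]%R.
Proof.
move=> mF; rewrite -[X in measurable X]setTI.
rewrite [X in _ `&` X](_ : _ = F @^-1` `]0%R, +oo[).
  exact: mF.
by apply/seteqP; split => x /=; rewrite in_itv/= andbT.
Qed.

Definition pos_sets : set (set rfield) :=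
  [set B | exists2 F, finite_min F & B = [set x | 0 < F x]%R].

Lemma pos_sets_setI : setI_closed pos_sets.
Proof.
move=> _ _ [F fF ->] [G fG ->].
exists (fun x => Num.min (F x) (G x)); first exact: finite_min_min.
by apply/seteqP; split => x /=; rewrite lt_min => /andP.
Qed.

(** A coordinate is measurable for the sigma-algebra generated by [pos_sets]
    because the half-lines [x_i > a] are among these sets. *)
Lemma measurable_pos_setsE : @measurable _ rfield = <<s pos_sets >>.
Proof.
apply/seteqP; split; last first.
  apply: smallest_sub; first exact: sigma_algebra_measurable.
  move=> _ [F /finite_min_measurable mF ->]; exact: measurable_pos_set.
apply: smallest_sub; first exact: smallest_sigma_algebra.
move=> _ [i _ [B mB <-]]; rewrite setTI.
pose T := g_sigma_algebraType pos_sets.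
have : measurable_fun [set: T] (fun x : T => (x : rfield) i).
  apply: (measurability _ (measurable_realfun.RGenOInfty.measurableE R)) => _ [_ [a ->] <-].
  rewrite setTI; apply: sub_sigma_algebra; exists (fun x => x i - a)%R.
    apply: (@finite_min_coord i (fun t : R => t - a)%R) => t.
    by apply: cvgB; [exact: cvg_id|exact: cvg_cst].
  by apply/seteqP; split => x /=; rewrite in_itv/= andbT subr_gt0.
by move=> /(_ measurableT B mB); rewrite setTI.
Qed.

(** The pi-lambda theorem for open cylinders. *)
Lemma eq_measure_pos_sets (m1 m2 : {measure set rfield -> \bar R}) :
  m1 setT < +oo ->
  (forall F, finite_min F -> m1 [set x | 0 < F x]%R = m2 [set x | 0 < F x]%R) ->
  forall B, measurable B -> m1 B = m2 B.
Proof.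
move=> m1fin m12 B mB.
apply: (@measure_unique _ _ _ pos_sets (fun=> setT)) => //.
- exact: measurable_pos_setsE.
- exact: pos_sets_setI.
- move=> _; exists (fun=> 1%R); last by apply/seteqP; split => x //= _; exact: ltr01.
  by apply: (@finite_min_coord 0%R (fun=> 1%R)) => t; exact: cvg_cst.
- by rewrite bigcup_const//; exists O.
- by move=> _ [F fF ->]; exact: m12.
Qed.

End product_space.

HB.instance Definition _ (d : nat) (R : realType) (k : 'rV[int]_d) :=
  isMeasurableFun.Build _ _ _ _ (@fshift d R k) (measurable_fshift k).

(** * Invariance of the tail process under shifts to exceedances *)

Section ramp.
Set Implicit Arguments.
Unset Strict Implicit.
Context {R : realType}.
Implicit Types (n : nat) (t : R).

(** Continuous functions increasing with [n] to the indicator of [t > 0]; they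
    vanish where [t <= 0], which is what removes the conditioning event in
    [tail_limit]. *)
Definition ramp n t : R := Num.min 1%R (n%:R * Num.max 0 t)%R.

Lemma ramp_ge0 n t : (0 <= ramp n t)%R.
Proof. by rewrite le_min ler01 mulr_ge0// le_max lexx. Qed.

Lemma ramp_le1 n t : (ramp n t <= 1)%R.
Proof. by rewrite ge_min lexx. Qed.

Lemma ramp_le0 n t : (t <= 0)%R -> ramp n t = 0%R.
Proof. by move=> t0; rewrite /ramp max_l// mulr0 min_r. Qed.

Lemma ramp_continuous n : continuous (ramp n).
Proof.
move=> t; apply: (@continuous_min _ _ (fun=> 1%R) _ t); first exact: cvg_cst.
apply: cvgZr; apply: (@continuous_max _ _ (fun=> 0%R) _ t); first exact: cvg_cst.
exact: cvg_id.
Qed.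

Lemma ramp_cvg t : ramp n t @[n --> \oo] --> (\1_[set s | 0 < s]%R t : R).
Proof.
have [t0|t0] := leP t 0%R.
  rewrite indicE memNset/= ?ltNge ?t0//.
  under eq_fun do rewrite ramp_le0//.
  exact: cvg_cst.
rewrite indicE mem_set//=; apply: cvg_near_cst.
(* the ramp reaches its value 1 at t as soon as n >= 1 / t *)
exists (Num.trunc t^-1).+1 => // n /= tn.
rewrite /ramp max_r ?ltW// min_l// -ler_pdivrMr// mul1r.
by rewrite (le_trans (ltW (truncnS_gt _)))// ler_nat.
Qed.

End ramp.

Section tail_shift.
Set Implicit Arguments.
Unset Strict Implicit.
Context {d : nat} {R : realType}.
Local Notation rfield := (rfield d R).
Local Notation index := 'rV[int]_d.
Context {dX : measure_display} {OX : measurableType dX} {PX : probability OX R}.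
Context {dY : measure_display} {OY : measurableType dY} {PY : probability OY R}.
Context {X : {RV PX >-> rfield}} {Y : {RV PY >-> rfield}}.
Hypothesis hX : stationary X.
Hypothesis hXY : tail_process X Y.

Let scaled (u : R) (w : OX) : rfield := (fun i => u^-1 * X w i)%R.

(** The integrand vanishes where [|X_0| <= u], so the conditional expectation given
    [|X_0| > u] has an unrestricted integral as numerator. *)
Lemma tail_limit (n : nat) (F : rfield -> R) : finite_min F ->
    (forall x, 0 < F x -> 1 < `|x 0| )%R ->
  ((\int[PX]_w ramp n (F (scaled u w))) / fine (PX [set w | u < `|X w 0|]))%R
    @[u --> +oo%R] --> (\int[PY]_w ramp n (F (Y w)))%R.
Proof.
move=> fF F1; have [_ _ wcvg] := hXY.
have [m _ /(_ m (leqnn m))[f cf Ff]] := finite_min_box fF.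
have := wcvg m (ramp n \o f).
have -> : (\int[PY]_w (ramp n \o f) (box_restr m (Y w)) =
    \int[PY]_w ramp n (F (Y w)))%R.
  by apply: eq_Rintegral => w _ /=; rewrite Ff.
move=> H; apply: cvg_trans (H _ _); last 2 first.
- by move=> y; apply: continuous_comp; [exact: cf|exact: ramp_continuous].
- exists 1%R => y /=; by rewrite ger0_norm ?ramp_ge0 ?ramp_le1.
apply: near_eq_cvg; near=> u.
have u0 : (0 < u)%R by near: u; exact: nbhs_pinfty_gt.
rewrite /cond_expect; congr (_ / _)%R.
rewrite Rintegral_mkcond; apply: eq_Rintegral => w _.
rewrite patchE /=; case: ifPn => [_|]; first by rewrite -Ff.
rewrite notin_setE /= => /negP; rewrite -leNgt => Xu.
rewrite ramp_le0// leNgt; apply/negP => /F1.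
rewrite normrM ger0_norm ?invr_ge0 ?ltW// mulrC ltr_pdivlMr// mul1r.
by rewrite ltNge Xu.
Unshelve. all: by end_near. Qed.

Lemma stationary_integral (k : index) (G : rfield -> \bar R) :
  measurable_fun setT G -> (forall x, 0 <= G x) ->
  \int[PX]_w G (fshift k (X w)) = \int[PX]_w G (X w).
Proof.
move=> mG G0.
have mGk : measurable_fun setT (G \o fshift k).
  by apply: measurableT_comp => //; exact: measurable_fshift.
rewrite -(ge0_integral_distribution X mG)//.
rewrite -(ge0_integral_distribution X mGk); last by move=> x; exact: G0.
rewrite -[LHS](ge0_integral_pushforward (measurable_fshift k) _ measurableT mG)//.
by apply: eq_measure_integral => B mB _; exact: hX.
Qed.


Lemma ramp_integral_cvg {dT} {T : measurableType dT} (P : probability T R)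
    (G : T -> R) : measurable_fun setT G ->
  \int[P]_w (ramp n (G w))%:E @[n --> \oo] --> P [set w | 0 < G w]%R.
Proof.
move=> mG.
have mpos : measurable [set w | 0 < G w]%R by exact: measurable_pos_set.
rewrite -[X in _ --> P X]setIT -(integral_indic _ measurableT mpos).
apply: (@dominated_cvg _ _ _ P setT measurableT _ _ (cst 1)) => //.
- move=> n; apply/measurable_EFinP; apply: measurableT_comp => //.
  by apply: continuous_measurable_fun; exact: ramp_continuous.
- by move=> w _; apply: cvg_EFin; [exact: nearW|exact: ramp_cvg].
- exact: finite_measure_integrable_cst.
- by move=> n w _; rewrite /= lee_fin ger0_norm ?ramp_ge0 ?ramp_le1.
Qed.

(** Both sides are limits of the quotients of [tail_limit], for [F o phi_k] and for
    [F].  At each fixed [u] the two quotients coincide by stationarity.  The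
    condition on [x_0] makes [tail_limit] applicable to [F], and the condition on
    [x_{-k}] makes it applicable to [F o phi_k]. *)
Lemma tail_ramp_shift (k : index) (n : nat) (F : rfield -> R) : finite_min F ->
    (forall x, 0 < F x -> 1 < `|x 0| /\ 1 < `|x (- k)| )%R ->
  \int[PY]_w (ramp n (F (fshift k (Y w))))%:E = \int[PY]_w (ramp n (F (Y w)))%:E.
Proof.
move=> fF F1.
have mramp (G : rfield -> R) : finite_min G -> measurable_fun setT (fun x => (ramp n (G x))%:E).
  move=> /finite_min_measurable mG; apply/measurable_EFinP.
  apply: measurableT_comp => //; apply: continuous_measurable_fun.
  exact: ramp_continuous.
have fin (G : rfield -> R) : finite_min G -> \int[PY]_w (ramp n (G (Y w)))%:E \is a fin_num.
  move=> fG; rewrite ge0_fin_numE; last first.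
    by apply: integral_ge0 => w _; rewrite lee_fin ramp_ge0.
  apply: (@le_lt_trans _ _ (\int[PY]_w (cst 1 w))); last first.
    by rewrite integral_cst// mul1e (le_lt_trans (probability_le1 PY measurableT))// ltry.
  apply: ge0_le_integral => //.
  - by move=> w _; rewrite lee_fin ramp_ge0.
  - exact: (measurableT_comp (mramp _ fG) (measurable_funPT Y)).
  - by move=> w _; rewrite lee_fin ramp_le1.
have fFk := finite_min_shift k fF.
rewrite -[LHS](fineK (fin _ fFk)) -[RHS](fineK (fin _ fF)); congr EFin.
have cvgF := tail_limit (n := n) fF (fun x Fx => (F1 x Fx).1).
have : forall x, (0 < F (fshift k x) -> 1 < `|x 0|)%R.
  by move=> x /F1[_]; rewrite /fshift addNr.
move=> /(tail_limit (n := n) fFk) cvgFk; apply: (cvg_unique _ cvgFk) => //.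
apply: cvg_trans cvgF; apply: near_eq_cvg; apply: nearW => u; congr (_ / _)%R.
rewrite /Rintegral; congr fine.
(* scaling commutes with the shift: G o fshift k is the integrand for F o fshift k *)
pose G x := (ramp n (F (fun i => u^-1 * x i)%R))%:E.
apply/esym; apply: (@stationary_integral k G) => [|x].
  exact: (measurableT_comp (mramp _ fF) (measurable_field_scale u^-1)).
by rewrite lee_fin ramp_ge0.
Qed.

(** The shift by [k] sends the pair of points [0, k] of a field to the pair
    [-k, 0]: the preimage of this event under [fshift k] is the event that [0] and
    [k] are exceedances. *)
Definition both_exceed (k : index) : set rfield :=
  [set x | 1 < `|x 0| /\ 1 < `|x (- k)| ]%R.

(** A function of the class [finite_min] that is positive exactly on
    [both_exceed k]: taking minima with it confines open cylinders to that set. *)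
Definition both_excess (k : index) (x : rfield) : R :=
  Num.min (`|x 0| - 1)%R (`|x (- k)| - 1)%R.

Lemma finite_min_both_excess k : finite_min (both_excess k).
Proof.
have c : continuous (fun t : R => `|t| - 1)%R.
  by move=> t; apply: cvgB; [exact: norm_continuous|exact: cvg_cst].
by apply: finite_min_min; exact: (finite_min_coord _ c).
Qed.

Lemma both_excess_gt0 k x : (0 < both_excess k x)%R <-> both_exceed k x.
Proof.
rewrite /both_excess lt_min !subr_gt0.
by split=> [/andP|[? ?]]; last exact/andP.
Qed.

Lemma measurable_both_exceed k : measurable (both_exceed k).
Proof.
rewrite (_ : both_exceed k = [set x | 0 < both_excess k x]%R).
  apply: measurable_pos_set; apply: finite_min_measurable.
  exact: finite_min_both_excess.
by apply/seteqP; split => x /both_excess_gt0.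
Qed.


Lemma tail_law_shift_pos (k : index) (F : rfield -> R) : finite_min F ->
    (forall x, 0 < F x -> 1 < `|x 0| /\ 1 < `|x (- k)| )%R ->
  PY [set w | 0 < F (fshift k (Y w))]%R = PY [set w | 0 < F (Y w)]%R.
Proof.
move=> fF F1.
have mY (G : rfield -> R) : finite_min G -> measurable_fun setT (G \o Y).
  by move=> /finite_min_measurable mG; exact: measurableT_comp.
have := ramp_integral_cvg (P := PY) (mY _ fF).
under eq_fun do rewrite /= -(tail_ramp_shift _ fF F1).
exact: cvg_unique (ramp_integral_cvg (P := PY) (mY _ (finite_min_shift k fF))).
Qed.

(** Both laws, restricted to [both_exceed k], are compared on open cylinders. *)
Lemma tail_law_shift (k : index) (B : set rfield) :
  measurable B -> B `<=` both_exceed k ->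
  distribution PY Y (fshift k @^-1` B) = distribution PY Y B.
Proof.
move=> mB Bk; have mk := measurable_both_exceed k.
suff : mrestr (pushforward (distribution PY Y) (fshift k)) mk B =
       mrestr (distribution PY Y) mk B.
  by rewrite /mrestr setIidl.
apply: eq_measure_pos_sets => // [|F fF].
  rewrite /= /mrestr setTI /pushforward.
  apply: (le_lt_trans (@probability_le1 _ _ _ (distribution PY Y) _ _)).
    exact: measurable_funPTI.
  exact: ltry.
have fFk := finite_min_min fF (finite_min_both_excess k).
have FkE x : (0 < Num.min (F x) (both_excess k x))%R <->
    ([set x | 0 < F x]%R `&` both_exceed k) x.
  by rewrite lt_min /= -both_excess_gt0; split => /andP.
rewrite /= /mrestr /pushforward.
transitivity (PY [set w | 0 < Num.min (F (fshift k (Y w)))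
                              (both_excess k (fshift k (Y w)))]%R).
  by congr (PY _); apply/seteqP; split => w /= /FkE.
rewrite (tail_law_shift_pos fFk) => [|x /FkE[]//].
by congr (PY _); apply/seteqP; split => w /= /FkE.
Qed.

(** The shift property of tail processes on exceedances: moving the origin to
    another exceedance preserves the law. *)
Lemma tail_integral_shift (k : index) (F : rfield -> \bar R) :
    measurable_fun setT F -> (forall x, 0 <= F x) ->
    (forall x, ~ both_exceed k x -> F x = 0) ->
  \int[distribution PY Y]_x F (fshift k x) = \int[distribution PY Y]_x F x.
Proof.
move=> mF F0 Fk.
have FD : F = F \_ (both_exceed k).
  apply/funext => x; rewrite patchE; case: ifPn => // /negP.
  by rewrite inE => /Fk.
rewrite -[LHS](ge0_integral_pushforward (measurable_fshift k) _ measurableT mF)//.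
rewrite FD -!integral_mkcond; apply: eq_measure_integral => B mB Bk.
exact: tail_law_shift.
Qed.

End tail_shift.

(** * Sums over a countable index type *)

Section countable_index.
Set Implicit Arguments.
Unset Strict Implicit.
Context {I : countType} {R : realType}.

(** Enumerating the index type by [pickle] turns an unordered sum into a series,
    which gives access to the monotone convergence theorem.  Integers that are not
    codes contribute [0]. *)
Lemma esum_nneseries (a : I -> \bar R) : (forall i, 0 <= a i) ->
  \esum_(i in [set: I]) a i = \sum_(0 <= n <oo) oapp a 0 (pickle_inv n).
Proof.
move=> a0; rewrite nneseries_esumT; last by move=> n; case: (pickle_inv n).
have pickle_bij : set_bij [set: I] (range (@choice.pickle I)) choice.pickle.
  by apply: inj_bij => i j _ _; exact: (pcan_inj choice.pickleK).
transitivity (\esum_(n in range (@choice.pickle I)) oapp a 0 (pickle_inv n)).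
  rewrite (reindex_esum _ _ _ _ pickle_bij).
  by apply: eq_esum => i _; rewrite pickleK_inv.
rewrite esum_mkcond; apply: eq_esum => n _.
case: ifPn => // /negP; rewrite inE => nI.
case E : (pickle_inv n) => [i|//]; exfalso; apply: nI; exists i => //.
by have := @pickle_invK I n; rewrite E.
Qed.

Lemma ge0_integral_esum {dT : measure_display} {T : measurableType dT}
    (mu : {measure set T -> \bar R}) (D : set T) (f : I -> T -> \bar R) :
    measurable D -> (forall i, measurable_fun D (f i)) ->
    (forall i x, D x -> 0 <= f i x) ->
  \int[mu]_(x in D) (\esum_(i in [set: I]) f i x) =
  \esum_(i in [set: I]) \int[mu]_(x in D) f i x.
Proof.
move=> mD mf f0; rewrite esum_nneseries; last first.
  by move=> i; apply: integral_ge0 => x; exact: f0.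
transitivity (\int[mu]_(x in D)
    (\sum_(0 <= n <oo) oapp (f ^~ x) 0 (pickle_inv n : option I))).
  by apply: eq_integral => x /[!inE] Dx; rewrite esum_nneseries// => i; exact: f0.
rewrite integral_nneseries// => [|n|n x Dx].
- apply: eq_eseriesr => n _; case: (pickle_inv n) => [i//|/=].
  exact: integral0.
- by case: (pickle_inv n) => [i|] /=; [exact: mf|exact: measurable_cst].
- by case: (pickle_inv n) => [i|//] /=; exact: f0.
Qed.

Lemma measurable_fun_esum {dT : measure_display} {T : measurableType dT}
    (f : I -> T -> \bar R) :
    (forall i, measurable_fun setT (f i)) -> (forall i x, 0 <= f i x) ->
  measurable_fun setT (fun x => \esum_(i in [set: I]) f i x).
Proof.
move=> mf f0; under eq_fun do rewrite esum_nneseries//.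
apply: (ge0_emeasurable_sum (P := predT)) => [n x _ _|n _].
  by case: (pickle_inv n) => [i|//] /=; exact: f0.
by case: (pickle_inv n) => [i|] /=; [exact: mf|exact: measurable_cst].
Qed.

(** Measurability is local with respect to a countable measurable partition, given
    here as the fibres of a classifying map [c]. *)
Lemma measurable_fun_pieces {d1 d2 : measure_display} {T : measurableType d1}
    {U : measurableType d2} (D : set T) (c : T -> I) (f : T -> U) :
    (forall i, measurable (D `&` c @^-1` [set i])) ->
    (forall i, measurable_fun (D `&` c @^-1` [set i]) f) ->
  measurable_fun D f.
Proof.
move=> mc mf _ B mB.
rewrite (_ : D `&` _ = \bigcup_i (D `&` c @^-1` [set i] `&` f @^-1` B)).
  by apply: countable_bigcupT_measurable => // i; exact: mf.
by apply/seteqP; split => [x [Dx Bx]|x [i _ [[Dx _] Bx]]] //; exists (c x).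
Qed.

End countable_index.

(** * Exceedance sets *)

Section exceedances.
Set Implicit Arguments.
Unset Strict Implicit.
Context {d : nat} {R : realType}.
Local Notation rfield := (rfield d R).
Local Notation index := 'rV[int]_d.
Implicit Types (i k : index) (x : rfield).

Lemma exceed_fshift k x : exceed (fshift k x) = (+%R^~ k) @^-1` exceed x.
Proof. by []. Qed.

Lemma exceed_fshift0 k x : exceed (fshift k x) 0%R <-> exceed x k.
Proof. by rewrite exceed_fshift /= add0r. Qed.

Lemma finite_exceed_fshift k x :
  finite_set (exceed (fshift k x)) <-> finite_set (exceed x).
Proof.
have fin l (y : rfield) : finite_set (exceed y) -> finite_set (exceed (fshift l y)).
  by move=> fy; rewrite exceed_fshift; apply: finite_preimage => // i j _ _ /addIr.
split; last exact: fin.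
by move/(fin (- k)%R); rewrite fshiftD addNr fshift0.
Qed.

Lemma card_exceed_fshift k x : finite_set (exceed x) ->
  #|` fset_set (exceed (fshift k x))| = #|` fset_set (exceed x)|.
Proof.
move=> fx; have fkx := (finite_exceed_fshift k x).2 fx.
rewrite (_ : exceed x = (+%R^~ k) @` exceed (fshift k x)).
  by rewrite fset_set_image// card_imfset//; exact: addIr.
apply/seteqP; split => [i xi|_ [i ki <-]]; last exact: ki.
by exists (i - k)%R; rewrite ?subrK//= exceed_fshift /= subrK.
Qed.

Lemma E0_exceed0 x : E0 x -> exceed x 0%R.
Proof. by case. Qed.

(** The shifts of [x] that stay in [E0] are those by exceedance-points of [x]. *)
Lemma E0_fshift k x : E0 x -> E0 (fshift k x) <-> exceed x k.
Proof.
move=> [_ fx]; split => [[/exceed_fshift0//]|xk].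
by split; [exact/exceed_fshift0|exact/finite_exceed_fshift].
Qed.

Lemma measurable_exceed k : measurable [set x : rfield | exceed x k].
Proof.
rewrite (_ : mkset _ = [set x : rfield | 0 < `|x k| - 1]%R).
  apply: measurable_pos_set; apply: measurable_funB => //.
  by apply: measurableT_comp => //; exact: measurable_coord.
by apply/seteqP; split => x /=; rewrite subr_gt0.
Qed.

Lemma measurable_exceed_eq (A : set index) :
  measurable [set x : rfield | exceed x = A].
Proof.
rewrite (_ : mkset _ =
    ~` \bigcup_k [set x : rfield | exceed x k <> A k]).
  apply: measurableC; apply: countable_bigcupT_measurable => // k.
  have [Ak|Ak] := pselect (A k).
    rewrite (_ : mkset _ = ~` [set x : rfield | exceed x k]).
      by apply: measurableC; exact: measurable_exceed.
    apply/seteqP; split => x /= H.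
      by move=> xk; apply: H; apply/propext.
    by move=> E; apply: H; rewrite E.
  rewrite (_ : mkset _ = [set x : rfield | exceed x k]).
    exact: measurable_exceed.
  apply/seteqP; split => x /= H.
    by apply: contrapT => xk; apply: H; apply/propext.
  by move=> E; apply: Ak; rewrite -E.
apply/seteqP; split => x => [<- [k _]|H /=]; first exact.
by apply/funext => k; apply: contrapT => xk; apply: H; exists k.
Qed.

(** There are only countably many finite sets of indices, so finiteness of the
    exceedance set is a countable union of measurable conditions. *)
Lemma measurable_E0 : measurable (@E0 d R).
Proof.
rewrite (_ : E0 = [set x : rfield | exceed x 0%R] `&`
    \bigcup_(F : {fset index}) [set x : rfield | exceed x = [set` F]]).
  apply: measurableI; first exact: measurable_exceed.
  apply: countable_bigcupT_measurable => // F; exact: measurable_exceed_eq.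
apply/seteqP; split => [x [x0 fx]|x [x0 [F _ /= xF]]]; split=> //.
  by exists (fset_set (exceed x)) => //=; rewrite fset_setK.
by rewrite xF; exact: finite_fset.
Qed.

End exceedances.

(** * Anchoring and mass transport *)

Section anchoring_functions.
Set Implicit Arguments.
Unset Strict Implicit.
Context {d : nat} {R : realType}.
Local Notation rfield := (rfield d R).
Local Notation index := 'rV[int]_d.
Variable A : rfield -> index.
Hypothesis hA : anchoring A.
Implicit Types (i k : index) (x : rfield).

Let mA B : measurable (E0 `&` A @^-1` B). Proof. by case: hA. Qed.

Let exceedA x : E0 x -> exceed x (A x). Proof. by case: hA => _ + _; exact. Qed.

Let anchor_fshift x k : E0 x -> exceed x k -> (A (fshift k x) + k = A x)%R.
Proof. by case: hA => _ _; exact. Qed.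

Definition anchored : set rfield := E0 `&` A @^-1` [set 0%R].

Lemma measurable_anchored : measurable anchored.
Proof. exact: mA. Qed.

(** Equivariance of [A] read at the anchor: [A x] is the only shift of [x] that
    becomes anchored at the origin. *)
Lemma anchored_fshift k x : E0 x -> anchored (fshift k x) <-> A x = k.
Proof.
move=> Ex; split => [[/(E0_fshift k Ex) xk /= A0]|<-].
  by rewrite -(anchor_fshift Ex xk) A0 add0r.
have xA := exceedA Ex; split; first exact/(E0_fshift _ Ex).
by apply/(@addIr _ (A x)); rewrite add0r anchor_fshift.
Qed.

(** Each of the finitely many versions of [x] seen from its exceedances receives an
    equal share of the value of [h] at the version seen from the anchor. *)
Definition anchor_average (h : rfield -> R) : rfield -> R :=
  (fun x => h (fshift (A x) x) / #|` fset_set (exceed x)|%:R)%R \_ E0.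

(** On the piece where the anchor is [k] and the exceedance set is [F], the function
    is [h o phi_k] divided by the constant [|F|]. *)
Lemma measurable_anchor_average (h : rfield -> R) :
  measurable_fun E0 h -> measurable_fun setT (anchor_average h).
Proof.
move=> mh; apply/(measurable_restrictT _ measurable_E0).
pose c x := (A x, fset_set (exceed x)).
have cE k (F : {fset index}) : E0 `&` c @^-1` [set (k, F)] =
    (E0 `&` A @^-1` [set k]) `&` [set x | exceed x = [set` F]].
  apply/seteqP; split => [x [Ex [Ak xF]]|x [[Ex Ak] /= xF]].
    by split=> //=; rewrite -xF fset_setK//; case: Ex.
  by split=> //=; rewrite /c Ak xF set_fsetK.
apply: (measurable_fun_pieces (c := c)) => [[k F]|[k F]]; rewrite cE.
  by apply: measurableI => //; exact: measurable_exceed_eq.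
apply: (@eq_measurable_fun _ _ _ _ _ (fun x => h (fshift k x) / #|` F|%:R)%R).
  by move=> x /[!inE] -[[_ ->] /= ->]; rewrite set_fsetK.
apply: measurable_funM => //.
apply: (@measurable_comp _ _ _ _ _ _ E0) => //; first exact: measurable_E0.
  move=> _ [x [[Ex <-] _] <-]; apply/(E0_fshift _ Ex); exact: exceedA.
by apply: measurable_funS (measurable_fshift k).
Qed.

Lemma anchor_average_ge0 (h : rfield -> R) x :
  (forall y, E0 y -> 0 <= h y)%R -> (0 <= anchor_average h x)%R.
Proof.
move=> h0; rewrite /anchor_average patchE; case: ifPn => // /[!inE] Ex.
by apply: divr_ge0 => //; apply/h0/(E0_fshift _ Ex)/exceedA.
Qed.

(** The shares add up: by equivariance all [|e(x)|] nonzero terms equal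
    [h x / |e(x)|]. *)
Lemma esum_anchor_average (h : rfield -> R) x :
    (forall y, E0 y -> 0 <= h y)%R -> anchored x ->
  \esum_(k in [set: index]) (anchor_average h (fshift k x))%:E = (h x)%:E.
Proof.
move=> h0 [Ex /= A0]; have fx : finite_set (exceed x) by case: Ex.
set N := #|` fset_set (exceed x)|.
have avgE k : anchor_average h (fshift k x) =
    if k \in exceed x then (h x / N%:R)%R else 0%R.
  rewrite /anchor_average patchE; case: ifPn => [|/negP] /[!inE]; last first.
    by move/(E0_fshift k Ex) => xk; rewrite memNset.
  move=> /(E0_fshift k Ex) xk; rewrite mem_set// card_exceed_fshift// fshiftD.
  by rewrite anchor_fshift// A0 fshift0.
transitivity (\esum_(k in exceed x) (h x / N%:R)%:E).
  rewrite [RHS]esum_mkcond; apply: eq_esum => k _; rewrite avgE.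
  by case: ifP.
rewrite esum_fset//; last by move=> k _; rewrite lee_fin divr_ge0// h0.
rewrite fsbig_finite//= sumEFin big_const_seq count_predT iter_addr addr0.
rewrite -(mulr_natr (h x / N%:R)%R) divfK// pnatr_eq0 cardfs_eq0; apply/eqP => N0.
have := E0_exceed0 Ex; have := in_fset_set fx 0%R.
by rewrite N0 inE => /esym /negbT/negP; rewrite inE => n0 /n0.
Qed.

Section mass_transport.
Variable mu : {measure set rfield -> \bar R}.
Hypothesis mu_shift : forall k (F : rfield -> \bar R),
  measurable_fun setT F -> (forall x, 0 <= F x) ->
  (forall x, ~ both_exceed k x -> F x = 0) ->
  \int[mu]_x F (fshift k x) = \int[mu]_x F x.
Variable H : rfield -> \bar R.
Hypothesis mH : measurable_fun setT H.
Hypothesis H0 : forall x, 0 <= H x.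
Hypothesis HE0 : forall x, ~ E0 x -> H x = 0.

Let mHk k : measurable_fun setT (H \o fshift k).
Proof. by apply: measurableT_comp => //; exact: measurable_fshift. Qed.

(** The invariance is applied to the function that is [H o phi_{-k}] on
    [anchored] and [0] elsewhere.  Composed with the shift by [k] it becomes [H]
    restricted to [A = k]; and it vanishes unless [0] and [-k] are both
    exceedances, because anchored fields and the support of [H] lie in [E0]. *)
Lemma anchor_transport k :
  \int[mu]_(x in E0 `&` A @^-1` [set k]) H x =
  \int[mu]_(x in anchored) H (fshift (- k)%R x).
Proof.
rewrite integral_mkcond [RHS]integral_mkcond.
rewrite -[RHS](@mu_shift k); last first.
- move=> x xk; rewrite patchE; case: ifPn => // /[!inE] -[Ex _].
  apply: HE0 => /(E0_fshift (- k)%R Ex) xNk; apply: xk; split => //.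
  exact: E0_exceed0.
- by move=> x; rewrite patchE; case: ifP => _; [exact: H0|exact: lexx].
- apply/(measurable_restrictT _ measurable_anchored).
  by apply: measurable_funTS; exact: mHk.
apply: eq_integral => x _; rewrite !patchE fshiftD addNr fshift0.
have [Ex|Ex] := pselect (E0 x); last by rewrite HE0// !if_same.
congr (if _ then _ else _); apply/idP/idP; rewrite !inE.
  by move=> [_ Ak]; apply/(anchored_fshift k Ex).
by move=> /(anchored_fshift k Ex).
Qed.

Lemma mass_transport :
  \int[mu]_x H x =
  \int[mu]_(x in anchored) \esum_(k in [set: index]) H (fshift k x).
Proof.
rewrite ge0_integral_esum//; last 2 first.
- exact: measurable_anchored.
- by move=> k; apply: measurable_funTS; exact: mHk.
(* an anchor at k corresponds to the shift by -k, hence the reindexing *)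
have opp_bij : set_bij [set: index] [set: index] -%R.
  by rewrite setTT_bijective; exists -%R; exact: opprK.
rewrite (reindex_esum _ _ _ _ opp_bij).
under eq_esum do rewrite -anchor_transport integral_mkcond.
rewrite -ge0_integral_esum//; last 2 first.
- move=> k; apply/(measurable_restrictT _ (mA _)); exact: measurable_funTS.
- by move=> k x _; rewrite patchE; case: ifP => _; [exact: H0|exact: lexx].
apply: eq_integral => x _.
have [Ex|Ex] := pselect (E0 x); last first.
  by rewrite HE0// esum1// => k _; rewrite patchE; case: ifP => // _; exact: HE0.
rewrite -[LHS](esum_set1 (t := A x) (a := fun=> H x))// esum_mkcond.
apply: eq_esum => k _; rewrite patchE; congr (if _ then _ else _).
by apply/idP/idP; rewrite !inE; [move=> ->; split|move=> [_ <-]].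
Qed.

End mass_transport.

End anchoring_functions.

(** * The law of the anchored process *)

Section anchored_law.
Set Implicit Arguments.
Unset Strict Implicit.
Context {d : nat} {R : realType}.
Local Notation rfield := (rfield d R).
Context {dY : measure_display} {OY : measurableType dY} {PY : probability OY R}.
Context {dZ : measure_display} {OZ : measurableType dZ} {PZ : probability OZ R}.
Context {Y : {RV PY >-> rfield}} {Z : {RV PZ >-> rfield}}.
Variable A : rfield -> 'rV[int]_d.
Hypothesis hA : anchoring A.
Hypothesis hZ : anchored_process Y A Z.

(** The law of [Z] has total mass [1], whereas conditioning on a null event would
    give the zero measure. *)
Lemma vartheta_neq0 : vartheta Y A != 0%R.
Proof.
apply/eqP => t0; have [_ /(_ setT measurableT)] := hZ.
rewrite /cond_prob -/(vartheta Y A) t0 invr0 mulr0 probability_setT.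
by move=> [] /eqP; rewrite oner_eq0.
Qed.

Lemma anchored_lawE (B : set rfield) : measurable B ->
  distribution PZ Z B =
  ((vartheta Y A)^-1)%:E * distribution PY Y (B `&` anchored A).
Proof.
move=> mB; have [_ ->//] := hZ.
rewrite /cond_prob mulrC EFinM; congr (_ * _); rewrite fineK//.
apply: fin_num_measure; rewrite -[anchored_at0 Y A]/(Y @^-1` anchored A).
rewrite -preimage_setI; apply: measurable_funPTI; apply: measurableI => //.
exact: measurable_anchored.
Qed.

(** The law of [Z] is carried by [anchored A], and on subsets of it equals the law
    of [Y] up to the factor [1 / vartheta]. *)
Lemma anchored_law_integral (K : rfield -> \bar R) :
    measurable_fun setT K -> (forall x, 0 <= K x) ->
  \int[distribution PZ Z]_x K x =
  ((vartheta Y A)^-1)%:E * \int[distribution PY Y]_(x in anchored A) K x.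
Proof.
move=> mK K0; have mA := measurable_anchored hA.
have t0 : (0 <= (vartheta Y A)^-1)%R by rewrite invr_ge0 fine_ge0.
have mAC : measurable (~` anchored A) by exact: measurableC.
have AC0 : distribution PZ Z (~` anchored A) = 0.
  by rewrite anchored_lawE// setICl measure0 mule0.
rewrite (@ge0_negligible_integral _ _ _ _ _ (~` anchored A))//.
rewrite setDE setCK setTI.
rewrite -[(vartheta Y A)^-1%R]/((NngNum t0)%:num) -ge0_integral_mscale//.
  apply: eq_measure_integral => B mB BA.
  by have := anchored_lawE mB; rewrite setIidl.
exact: measurable_funTS.
Qed.

End anchored_law.


Theorem proposition3p2 (d : nat) (hd : (0 < d)%N) (R : realType)
    (dX : measure_display) (OX : measurableType dX) (PX : probability OX R)
    (X : {RV PX >-> rfield d R})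
    (dY : measure_display) (OY : measurableType dY) (PY : probability OY R)
    (Y : {RV PY >-> rfield d R})
    (hX : stationary X) (hXY : tail_process X Y)
    (hY : PY (Y @^-1` E0) = 1)
    (A : rfield d R -> 'rV[int]_d) (hA : anchoring A)
    (dZ : measure_display) (OZ : measurableType dZ) (PZ : probability OZ R)
    (Z : {RV PZ >-> rfield d R}) (hZ : anchored_process Y A Z)
    (h : rfield d R -> R) (mh : measurable_fun (E0) h)
    (h0 : forall x, E0 x -> (0 <= h x)%R) :
  [/\ (\int[PY]_(w in Y @^-1` E0) (h (Y w))%:E =
       (vartheta Y A)%:E * (\esum_(k in [set: 'rV[int]_d])
         \int[PZ]_w (h (fshift k (Z w)) * (1 < `|Z w k|)%R%:R)%:E))%E,
      ((vartheta Y A)%:E * (\esum_(k in [set: 'rV[int]_d])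
         \int[PZ]_w (h (fshift k (Z w)) * (1 < `|Z w k|)%R%:R)%:E) =
       (vartheta Y A)%:E *
         \int[PZ]_w \esum_(k in exceed (Z w)) (h (fshift k (Z w)))%:E)%E
    & (\int[PZ]_w (h (Z w))%:E =
       ((vartheta Y A)^-1)%:E *
         \int[PY]_(w in Y @^-1` E0)
           (h (fshift (A (Y w)) (Y w)) / #|` fset_set (exceed (Y w))|%:R)%:E)%E].
Proof.
have t0 := vartheta_neq0 hZ; have mu_shift := tail_integral_shift hX hXY.
have [ZE0 _] := hZ.
have H0 (x : rfield d R) : (0 <= (h \_ E0) x)%R.
  by rewrite patchE; case: ifPn => // /[!inE] /h0.
have mH : measurable_fun setT (h \_ E0).
  by apply/(measurable_restrictT _ measurable_E0).
pose H x := ((h \_ E0) x)%:E.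
have Hge0 x : 0 <= H x by rewrite lee_fin.
have mHE : measurable_fun setT H by exact/measurable_EFinP.
have HE0 x : ~ E0 x -> H x = 0 by move=> Ex; rewrite /H patchE memNset.
have mHk k : measurable_fun setT (H \o fshift k) by exact: measurableT_comp.
have transport (G : rfield d R -> \bar R) : measurable_fun setT G ->
    (forall x, 0 <= G x) -> (forall x, ~ E0 x -> G x = 0) ->
    \int[distribution PY Y]_x G x =
    \int[distribution PY Y]_(x in anchored A)
      (\esum_(k in [set: 'rV[int]_d]) G (fshift k x)).
  by move=> mG G0 GE0; exact: (mass_transport hA mu_shift).
(* extending h by 0 outside E0 absorbs the indicator of |Z_k| > 1, as Z is in E0 *)
have hZk w k : (h (fshift k (Z w)) * (1 < `|Z w k|)%R%:R)%:E = H (fshift k (Z w)).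
  rewrite /H patchE; case: ifPn => [|/negP] /[!inE].
    by move=> /(E0_fshift k (ZE0 w)) /= ->; rewrite mulr1.
  move=> nE; case: (boolP (1 < `|Z w k|)%R) => [kw|_]; last by rewrite mulr0.
  by exfalso; apply: nE; apply/(E0_fshift k (ZE0 w)).
have sumZ : \esum_(k in [set: 'rV[int]_d])
      \int[PZ]_w (h (fshift k (Z w)) * (1 < `|Z w k|)%R%:R)%:E =
    \int[PZ]_w (\esum_(k in [set: 'rV[int]_d]) H (fshift k (Z w))).
  rewrite ge0_integral_esum// => [|k]; last first.
    exact: (measurableT_comp (mHk k) (measurable_funPT Z)).
  by apply: eq_esum => k _; apply: eq_integral => w _; exact: hZk.
have intZ : \int[PZ]_w (\esum_(k in [set: 'rV[int]_d]) H (fshift k (Z w))) =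
    ((vartheta Y A)^-1)%:E * \int[distribution PY Y]_x H x.
  rewrite (transport H)// -(anchored_law_integral hA hZ).
  - rewrite ge0_integral_distribution// => [|x]; last exact: esum_ge0.
    exact: measurable_fun_esum.
  - exact: measurable_fun_esum.
  - by move=> x; exact: esum_ge0.
have intY (g : rfield d R -> R) : measurable_fun setT (g \_ E0) ->
    (forall x, 0 <= (g \_ E0) x)%R ->
    \int[PY]_(w in Y @^-1` E0) (g (Y w))%:E =
    \int[distribution PY Y]_x ((g \_ E0) x)%:E.
  move=> mg g0; rewrite ge0_integral_distribution//; last exact/measurable_EFinP.
  rewrite integral_mkcond; apply: eq_integral => w _ /=.
  have [Ew|Ew] := pselect (E0 (Y w)); first by rewrite !patchE !mem_set.
  by rewrite !patchE !memNset.
split.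
- by rewrite intY// sumZ intZ muleA -EFinM mulfV// mul1e.
- rewrite sumZ; congr (_ * _); apply: eq_integral => w _.
  rewrite [RHS]esum_mkcond; apply: eq_esum => k _; rewrite -hZk.
  case: ifPn => [/[!inE] /= ->|/negP]; first by rewrite mulr1.
  by rewrite inE => /negP/negbTE ->; rewrite mulr0.
- have mavg := measurable_anchor_average hA mh.
  have avg0 x : (0 <= anchor_average A h x)%R by exact: anchor_average_ge0.
  rewrite (intY (fun x => h (fshift (A x) x) / #|` fset_set (exceed x)|%:R)%R)//.
  rewrite (transport (fun x => (anchor_average A h x)%:E))//; last 2 first.
  + exact/measurable_EFinP.
  + by move=> x Ex; rewrite /anchor_average patchE memNset.
  transitivity (\int[distribution PZ Z]_x H x).
    rewrite ge0_integral_distribution//; apply: eq_integral => w _ /=.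
    by rewrite /H patchE mem_set.
  rewrite (anchored_law_integral hA hZ)//; congr (_ * _).
  apply: eq_integral => x /[!inE] Ax; rewrite (esum_anchor_average hA)//.
  by rewrite /H patchE mem_set//; case: Ax.
Qed.
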